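(* Let $q$ be a power of $2$ and $a,b\in\mathbb{N}$. (1) If $\lfloor a/q\rfloor$ is odd, then the monomial $t^{2q^2}[a,b]$ precedes $[a+q,b]$. (2) If $\lfloor b/q\rfloor$ is odd, then the monomial $t^{4q^2}[a,b]$ precedes $[a,b+q]$.
   Context: $\mathbb{N}=\{0,1,2,\dots\}$. Let $g:\mathbb{N}\to\mathbb{N}$ be defined by $g(0)=0$, $g(2n)=4g(n)$, $g(2n+1)=g(2n)+1$. For $a,b\in\mathbb{N}$, $[a,b]$ denotes $t^{1+2g(a)+4g(b)}\in\mathbb{Z}/2[t]$; every $t^k$ with $k$ odd positive is uniquely of this form. Say $[c,d]$ precedes $[a,b]$ if $c+d<a+b$, or $c+d=a+b$ and $d<b$. *)

(* Defs.v *)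
From HB Require Import structures.
From mathcomp Require Import all_boot all_order all_algebra.
From mathcomp Require Import zify.

Set Implicit Arguments.
Unset Strict Implicit.
Unset Printing Implicit Defensive.

Import GRing.Theory.
Local Open Scope ring_scope.

(* The first argument is fuel bounding the number of binary digits of n; the
   defining recursion of g is recovered by g0, g_double and g_doubleS. *)
Fixpoint g_rec (k n : nat) : nat :=
  if k is k'.+1 then (4 * g_rec k' n./2 + odd n)%N else 0%N.

Definition g (n : nat) : nat := g_rec n n.

Lemma g_rec_fuel (k n : nat) : (n <= k)%N -> g_rec k n = g n.
Proof.
have z j : g_rec j 0 = 0%N by elim: j => //= j ->.
rewrite /g; have [m] := ubnP n; elim: m k n => // m IH [|k] [|n] //= lt_nm le_nk.
  by rewrite z.
rewrite (IH k) ?(IH n) //; lia.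
Qed.

Lemma g_half (n : nat) : g n = (4 * g n./2 + odd n)%N.
Proof.
case: n => // n; rewrite {1}/g /= g_rec_fuel //; lia.
Qed.

Lemma g0 : g 0 = 0%N.
Proof. by []. Qed.

Lemma g_double (n : nat) : g (2 * n) = (4 * g n)%N.
Proof. by rewrite g_half mul2n doubleK odd_double addn0. Qed.

Lemma g_doubleS (n : nat) : g (2 * n + 1) = (g (2 * n) + 1)%N.
Proof.
rewrite g_double g_half; have -> : ((2 * n + 1)./2 = n)%N by lia.
by have -> : odd (2 * n + 1) by lia.
Qed.

Definition bracket (a b : nat) : {poly 'F_2} := 'X^(1 + 2 * g a + 4 * g b).

Definition precedes (M N : {poly 'F_2}) : Prop :=
  exists c d a b : nat,
    [/\ M = bracket c d, N = bracket a b &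
        (c + d < a + b)%N \/ (c + d = a + b)%N /\ (d < b)%N].

(* The next two lemmas say that each 'X^k with k odd is bracket a b for a unique
   pair (a, b), so that the existential in precedes involves no choice. *)
Lemma bracket_inj (a b c d : nat) :
  bracket a b = bracket c d -> a = c /\ b = d.
Proof.
move=> /(congr1 (fun p : {poly 'F_2} => size p)); rewrite !size_polyXn => e.
have {e} : (g a + 2 * g b = g c + 2 * g d)%N by lia.
have [m] := ubnP (a + b + c + d); elim: m a b c d => // m IH a b c d le_m.
case: (posnP (a + b + c + d)) => [|pos]; first by lia.
rewrite (g_half a) (g_half b) (g_half c) (g_half d) => e.
have := IH a./2 b./2 c./2 d./2.
by lia.
Qed.

Lemma bracket_surj (k : nat) : odd k ->
  exists a b : nat, 'X^k = bracket a b.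
Proof.
move=> odd_k; suff [a [b e]] : exists a b, k./2 = (g a + 2 * g b)%N.
  by exists a, b; rewrite /bracket; congr 'X^_; lia.
move: k./2 => {odd_k} n; have [m] := ubnP n; elim: m n => // m IH n le_m.
case: (posnP n) => [->|pos]; first by exists 0%N, 0%N.
have [|a [b e]] := IH (n %/ 4)%N; first by lia.
exists (2 * a + odd n)%N, (2 * b + odd n./2)%N.
rewrite (g_half (2 * a + _)) (g_half (2 * b + _)).
have -> : ((2 * a + odd n)./2 = a)%N by lia.
have -> : ((2 * b + odd n./2)./2 = b)%N by lia.
by lia.
Qed.

(* Main.v *)
Require Import Defs.
From mathcomp Require Import all_boot all_order all_algebra.
From mathcomp Require Import zify.

(** Halving the even part of the exponent, [a, b] corresponds to the number
    g a + 2 g b, whose binary digits interleave those of a (even positions) and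
    of b (odd positions).  Multiplying by t^(2 q^2) or t^(4 q^2) adds q^2 or
    2 q^2 to it.  For q = 1 one follows the carry, which moves alternately
    through the digits of a and b: adding 1 when a is odd does not increase
    a + b, and adding 2 when b is odd increases a + b by at most 1, with d < b
    for the new pair (c, d) in case of equality.  The general case reduces to
    q = 1 because appending the same lowest digits to both pairs preserves the
    precedence order. *)

Import GRing.Theory.
Local Open Scope ring_scope.

Definition code (a b : nat) : nat := (g a + 2 * g b)%N.

Definition prec (c d a b : nat) : Prop :=
  (c + d < a + b)%N \/ (c + d = a + b)%N /\ (d < b)%N.

Lemma code_half (a b : nat) :
  code a b = (4 * code a./2 b./2 + odd a + 2 * odd b)%N.
Proof. by rewrite /code (g_half a) (g_half b); lia. Qed.

Lemma code_bits (a b : nat) (x y : bool) :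
  code (2 * a + x) (2 * b + y) = (4 * code a b + x + 2 * y)%N.
Proof.
rewrite code_half; have -> : ((2 * a + x)./2 = a)%N by lia.
have -> : ((2 * b + y)./2 = b)%N by lia.
lia.
Qed.

Lemma code_succ (a b : nat) :
  exists c d : nat, code c d = (code a b).+1 /\
    if odd a then (c + d <= a + b)%N : Prop else c = a.+1 /\ d = b.
Proof.
have [m] := ubnP a; elim: m a b => // m IH a b le_m.
have [odd_a|even_a] := boolP (odd a); last first.
  exists a.+1, b; split=> //.
  rewrite [LHS]code_half [in RHS]code_half.
  have -> : (a.+1./2 = a./2)%N by lia.
  lia.
have eab := code_half a b.
have [odd_b|even_b] := boolP (odd b); last first.
  (* The carry stops at the lowest digit of [b], so the sum is unchanged. *)
  exists (2 * a./2 + false)%N, (2 * b./2 + true)%N.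
  by rewrite code_bits; split; lia.
(* Clearing both lowest digits lowers the sum by 2, which pays for a possible increase by 1 on the
   halves. *)
have [|c [d [ecd le_cd]]] := IH a./2 b./2; first by lia.
exists (2 * c + false)%N, (2 * d + false)%N; rewrite code_bits; split; first lia.
by move: le_cd; case: ifP; lia.
Qed.

Lemma code_add2 (a b : nat) : odd b ->
  exists c d : nat, code c d = (code a b + 2)%N /\ prec c d a b.+1.
Proof.
move=> odd_b; have [c [d [ecd le_cd]]] := code_succ a./2 b./2.
(* If [a./2] is even, the sums tie and the second entry, [b - 1], decides. *)
exists (2 * c + odd a)%N, (2 * d + false)%N; rewrite code_bits.
split; first by rewrite (code_half a b); lia.
by move: le_cd; rewrite /prec; case: ifP; lia.
Qed.

Lemma prec_bits (c d a b : nat) (x y : bool) :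
  prec c d a b -> prec (2 * c + x) (2 * d + y) (2 * a + x) (2 * b + y).
Proof. by rewrite /prec; lia. Qed.

Lemma odd_divn_double (a q : nat) : odd (a %/ (2 * q)) = odd (a./2 %/ q).
Proof. by rewrite divnMA divn2. Qed.

(** Dropping the lowest digits turns adding [q ^ 2] into adding [(q / 2) ^ 2], whence induction on
    [k]. *)
Lemma code_add_sqr (k a b : nat) : odd (a %/ 2 ^ k) ->
  exists c d : nat,
    code c d = (code a b + (2 ^ k) ^ 2)%N /\ prec c d (a + 2 ^ k) b.
Proof.
elim: k a b => [|k IH] a b.
  rewrite divn1 => odd_a; have [c [d [ecd]]] := code_succ a b.
  by rewrite odd_a => le_cd; exists c, d; split; [lia|left; lia].
rewrite expnS odd_divn_double => /(IH a./2 b./2) [c [d [ecd p]]].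
exists (2 * c + odd a)%N, (2 * d + odd b)%N.
rewrite code_bits ecd (code_half a b) expnMn; split; first lia.
have -> : (a + 2 * 2 ^ k = 2 * (a./2 + 2 ^ k) + odd a)%N by lia.
rewrite [X in prec _ _ _ X](_ : b = 2 * b./2 + odd b)%N; last by lia.
exact: prec_bits.
Qed.

Lemma code_add_double_sqr (k a b : nat) : odd (b %/ 2 ^ k) ->
  exists c d : nat,
    code c d = (code a b + 2 * (2 ^ k) ^ 2)%N /\ prec c d a (b + 2 ^ k).
Proof.
elim: k a b => [|k IH] a b.
  by rewrite divn1 addn1 => /(code_add2 a).
rewrite expnS odd_divn_double => /(IH a./2 b./2) [c [d [ecd p]]].
exists (2 * c + odd a)%N, (2 * d + odd b)%N.
rewrite code_bits ecd (code_half a b) expnMn; split; first lia.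
(* Adding the even number [2 * 2 ^ k] keeps the lowest digit of [b]. *)
have -> : (b + 2 * 2 ^ k = 2 * (b./2 + 2 ^ k) + odd b)%N by lia.
rewrite [X in prec _ _ X _](_ : a = 2 * a./2 + odd a)%N; last by lia.
exact: prec_bits.
Qed.

Lemma precedes_code (n a b c d A B : nat) :
  code c d = (code a b + n)%N -> prec c d A B ->
  precedes ('X^(2 * n) * bracket a b) (bracket A B).
Proof.
move=> e p; exists c, d, A, B; split=> //.
by rewrite /bracket -exprD; congr 'X^_; move: e; rewrite /code; lia.
Qed.

Theorem theorem2p7 (q a b : nat) (hq : exists k : nat, q = (2 ^ k)%N) :
  (odd (a %/ q) -> precedes ('X^(2 * q ^ 2) * bracket a b) (bracket (a + q) b))
  /\
  (odd (b %/ q) -> precedes ('X^(4 * q ^ 2) * bracket a b) (bracket a (b + q))).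
Proof.
have [k ->] := hq; split.
  by case/(code_add_sqr k a b) => c [d [e p]]; apply: precedes_code e p.
case/(code_add_double_sqr k a b) => c [d [e p]].
by rewrite -[4%N]/(2 * 2)%N -mulnA; apply: precedes_code e p.
Qed.
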